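(* Let $q>3$ be a prime with $q\not\equiv 1\pmod 4$. Up to isomorphism, the left braces of order $4q$ with cyclic additive group and with $|\ker\lambda|=2q$ are exactly the three braces $B_{i,j}$ for $(i,j)\in\{(1,0),(1,1),(0,1)\}$, which are pairwise non-isomorphic, where $B_{i,j}=(\mathbb{Z}_q\times\mathbb{Z}_4,+,\circ)$ with $$\begin{pmatrix} n\\ m\end{pmatrix}+\begin{pmatrix} x\\ y\end{pmatrix}=\begin{pmatrix} n+x\\ m+y\end{pmatrix},\qquad \begin{pmatrix} n\\ m\end{pmatrix}\circ\begin{pmatrix} x\\ y\end{pmatrix}=\begin{pmatrix} n+(-1)^{jm}x\\ m+(-1)^{im}y\end{pmatrix}$$ for all $n,x\in\mathbb{Z}_q$ and $m,y\in\mathbb{Z}_4$. In particular, $$(B_{i,j},\circ)\cong\begin{cases}\mathbb{Z}_q\rtimes_{-1}\mathbb{Z}_4 & \text{if }(i,j)=(0,1),\\ \mathbb{Z}_2\times(\mathbb{Z}_q\rtimes_{-1}\mathbb{Z}_2) & \text{if }(i,j)=(1,1),\\ \mathbb{Z}_2^2\times\mathbb{Z}_q & \text{if }(i,j)=(1,0).\end{cases}$$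
   Context: A skew (left) brace is a triple $(B,+,\circ)$ where $(B,+)$ and $(B,\circ)$ are groups such that $a\circ(b+c)=a\circ b-a+a\circ c$ for all $a,b,c\in B$; it is a left brace if $(B,+)$ is abelian. The map $\lambda:(B,\circ)\to\mathrm{Aut}(B,+)$, $\lambda_a(b)=-a+a\circ b$, is a group homomorphism, with kernel $\ker\lambda$. Isomorphisms are bijections preserving both operations. $\mathbb{Z}_q\rtimes_{-1}\mathbb{Z}_4=\langle\sigma,\tau\mid\sigma^4=\tau^q=1,\ \sigma\tau\sigma^{-1}=\tau^{-1}\rangle$, and $\mathbb{Z}_q\rtimes_{-1}\mathbb{Z}_2$ is the dihedral group of order $2q$. *)

(* Defs.v *)
From HB Require Import structures.
From mathcomp Require Import all_boot all_order all_algebra all_fingroup all_solvable.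

Set Implicit Arguments.
Unset Strict Implicit.
Unset Printing Implicit Defensive.

Import GRing.Theory.
Local Open Scope ring_scope.

Declare Scope brace_scope.
Delimit Scope brace_scope with brace.
Reserved Notation "x ∘ y" (at level 40, left associativity).

(* A left brace: the abelian group (B, +) is the zmodType structure of B. *)
HB.mixin Record Zmodule_isLeftBrace B of GRing.Zmodule B := {
  circ : B -> B -> B;
  circ_one : B;
  circ_inv : B -> B;
  circA : associative circ;
  circ1b : left_id circ_one circ;
  circVb : left_inverse circ_one circ_inv circ;
  circD : forall a b c : B, circ a (b + c) = circ a b - a + circ a c
}.

#[short(type="leftBraceType")]
HB.structure Definition LeftBrace := {B of GRing.Zmodule B & Zmodule_isLeftBrace B}.

#[short(type="finLeftBraceType")]
HB.structure Definition FinLeftBrace := {B of LeftBrace B & Finite B}.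

Notation "x ∘ y" := (circ x y) : brace_scope.
Local Open Scope brace_scope.

HB.instance Definition _ (B : finLeftBraceType) := [finGroupMixin of B for +%R].

(* The carrier of B seen as the group (B, ∘); the group operations on B itself
   are those of (B, +). *)
Definition circ_group (B : Type) : Type := B.

HB.instance Definition _ (B : finLeftBraceType) := Finite.on (circ_group B).
HB.instance Definition _ (B : finLeftBraceType) :=
  Finite_isGroup.Build (circ_group B) (@circA B) (@circ1b B) (@circVb B).

Definition lambda (B : leftBraceType) (a b : B) : B := - a + a ∘ b.

Definition ker_lambda (B : finLeftBraceType) : {set B} :=
  [set a | [forall b, lambda a b == b]].

Definition brace_isom (B C : leftBraceType) : Prop :=
  exists f : B -> C, [/\ bijective f, {morph f : x y / x + y}
                       & {morph f : x y / x ∘ y}].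

(* The exponent m is the representative in {0, 1, 2, 3} of a class mod 4; as 4
   is even, its choice does not matter. *)
Definition Bij (q i j : nat) : Type := ('Z_q * 'Z_4)%type.

Definition Bij_circ (q i j : nat) (a b : Bij q i j) : Bij q i j :=
  let: (n, m) := a in let: (x, y) := b in
  (n + (-1) ^+ (j * m)%N * x, m + (-1) ^+ (i * m)%N * y).

Section BijBrace.
Variables q i j : nat.

HB.instance Definition _ := GRing.Zmodule.on (Bij q i j).
HB.instance Definition _ := Finite.on (Bij q i j).

Definition Bij_circ_inv (a : Bij q i j) : Bij q i j :=
  let: (n, m) := a in (- ((-1) ^+ (j * m)%N * n), - ((-1) ^+ (i * m)%N * m)).

Lemma sign_parity (R : pzRingType) k m n : odd m = odd n ->
  (-1) ^+ (k * m)%N = (-1) ^+ (k * n)%N :> R.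
Proof. by move=> e; rewrite -signr_odd -[RHS]signr_odd !oddM e. Qed.

Lemma odd_Z4D (x y : 'Z_4) : odd (x + y)%R = odd x (+) odd y.
Proof. by rewrite /= odd_mod // oddD. Qed.

Lemma odd_Z4N (x : 'Z_4) : odd (- x)%R = odd x.
Proof. by case: x => [[|[|[|[|]]]]]. Qed.

Lemma odd_Z4M k (x : 'Z_4) : odd ((-1) ^+ k * x)%R = odd x.
Proof. by rewrite -signr_odd mulr_sign; case: (odd k); rewrite ?odd_Z4N. Qed.

Lemma Bij_circA : associative (@Bij_circ q i j).
Proof.
move=> [n m] [x y] [u v] /=.
have e k (R : pzRingType) :
    (-1) ^+ (k * (m + (-1) ^+ (i * m)%N * y)%R)%N
      = (-1) ^+ (k * m)%N * (-1) ^+ (k * y)%N :> R.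
  rewrite -exprD -mulnDr; apply: sign_parity.
  by rewrite odd_Z4D odd_Z4M oddD.
by rewrite !e !mulrDr !addrA !mulrA.
Qed.

Lemma Bij_circ1b : left_id (0 : Bij q i j) (@Bij_circ q i j).
Proof. by case=> x y; rewrite /= !muln0 !expr0 !mul1r !add0r. Qed.

Lemma Bij_circVb :
  left_inverse (0 : Bij q i j) Bij_circ_inv (@Bij_circ q i j).
Proof.
case=> x y /=.
have e k (R : pzRingType) : (-1) ^+ (k * (- ((-1) ^+ (i * y)%N * y))%R)%N
      = (-1) ^+ (k * y)%N :> R.
  by apply: sign_parity; rewrite odd_Z4N odd_Z4M.
by rewrite !e !addNr.
Qed.

Lemma Bij_circD (a b c : Bij q i j) :
  Bij_circ a (b + c) = Bij_circ a b - a + Bij_circ a c.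
Proof.
move: a b c => [n m] [x y] [u v].
have e (V : zmodType) (s t w : V) : s + (t + w) = s + t - s + (s + w).
  by rewrite [s + t]addrC addrK addrCA.
by congr pair; rewrite /= mulrDr e.
Qed.

HB.instance Definition _ := Zmodule_isLeftBrace.Build (Bij q i j)
  Bij_circA Bij_circ1b Bij_circVb Bij_circD.

End BijBrace.

Definition Bij_indices : seq (nat * nat) := [:: (1, 0); (1, 1); (0, 1)]%N.

(* Main.v *)
Require Import Defs.
From HB Require Import structures.
From mathcomp Require Import all_boot all_order all_algebra all_fingroup all_solvable.

Set Implicit Arguments.
Unset Strict Implicit.
Unset Printing Implicit Defensive.

(* Identify (B, +) with Z_q x Z_4. As a ∘ b = a + b for a in ker lambda, the
   kernel is also an additive subgroup, of order 2q, hence it is Z_q x 2Z_4. Off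
   the kernel, a is k + e = k ∘ e with k in the kernel and e = (0, 1), so that
   lambda_a = lambda_e. The latter is an involution, since e ∘ e lies in the
   kernel, and an additive one, hence of the form ((-1)^j, (-1)^i), and it is not
   the identity. Conversely i and j can be read off the action of lambda on the
   4-torsion and on the q-torsion. *)

(** * The action lambda of a left brace on its additive group *)

Section LeftBraceTheory.

Local Open Scope ring_scope.
Local Open Scope brace_scope.
Import GRing.Theory.

Variable B : leftBraceType.
Implicit Types a b c : B.

(** Distributivity with both summands 0 leaves [a ∘ 0 - a = 0]; hence 0 is neutral for both
    operations. *)
Lemma circr0 a : a ∘ 0 = a.
Proof.
have /esym := circD a 0 0; rewrite addr0 -addrA => /(canRL (addKr _)).
by rewrite addNr addrC => /(canRL (subrK _)); rewrite add0r.
Qed.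

Lemma circ_lambda a b : a ∘ b = a + lambda a b.
Proof. by rewrite /lambda addNKr. Qed.

Lemma circ_inj a : injective (circ a).
Proof.
move=> b c eq_ab_ac.
by rewrite -[b]circ1b -[c]circ1b -(circVb a) -!circA eq_ab_ac.
Qed.

Lemma lambdaD a : {morph lambda a : b c / b + c}.
Proof. by move=> b c; rewrite /lambda circD !addrA. Qed.

(** Write [b ∘ c] as [b + lambda b c] in [a ∘ (b ∘ c)] and distribute: the term [a ∘ b] splits off
    and cancels. *)
Lemma lambda_circ a b c : lambda (a ∘ b) c = lambda a (lambda b c).
Proof.
by rewrite {1}/lambda -circA [b ∘ c]circ_lambda circD -!addrA addKr.
Qed.

Lemma lambda_eq0 a b : lambda a b = 0 -> b = 0.
Proof.
by move=> ab0; apply: (@circ_inj a); rewrite circr0 circ_lambda ab0 addr0.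
Qed.

End LeftBraceTheory.

(** * The kernel of lambda and transport along isomorphisms *)

Lemma ker_lambdaP (B : finLeftBraceType) (a : B) :
  reflect (forall b, lambda a b = b) (a \in ker_lambda B).
Proof.
by rewrite inE; apply: (iffP forallP) => a_id b; apply/eqP; apply: a_id.
Qed.

Lemma brace_isom_lambda (B C : leftBraceType) (f : B -> C) :
    {morph f : x y / x + y}%R -> {morph f : x y / circ x y} ->
  forall a b, f (lambda a b) = lambda (f a) (f b).
Proof.
move=> fD fM a b; apply: (GRing.addrI (f a)).
by rewrite -fD -!circ_lambda fM.
Qed.

Lemma brace_isom_sym (B C : leftBraceType) : brace_isom B C -> brace_isom C B.
Proof.
case=> f [[f' fK f'K] fD fM]; exists f'.
split; first by exists f.
- by move=> x y; apply: (can_inj fK); rewrite fD !f'K.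
by move=> x y; apply: (can_inj fK); rewrite fM !f'K.
Qed.

Lemma card_ker_lambda_isom (B C : finLeftBraceType) :
  brace_isom B C -> #|ker_lambda B| = #|ker_lambda C|.
Proof.
case=> f [[f' fK f'K] fD fM]; rewrite -(card_imset _ (can_inj fK)).
apply: eq_card => y; rewrite -[y]f'K mem_imset; last exact: can_inj fK.
have fL := brace_isom_lambda fD fM.
apply/ker_lambdaP/ker_lambdaP=> y_id b.
  by rewrite -[b]f'K -fL y_id.
by apply: (can_inj fK); rewrite fL y_id.
Qed.

(** Turns explicit bijections into group isomorphisms; it serves the circle groups, and also the
    additive groups, since the group law on a finite brace is its addition. *)
Lemma isog_bij (gT rT : finGroupType) (f : gT -> rT) :
  {morph f : x y / x * y}%g -> bijective f -> [set: gT] \isog [set: rT].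
Proof.
move=> fM [f' fK f'K]; apply/isogP.
exists (Morphism (D := setT) (fun x y _ _ => fM x y)).
  by apply/injmP=> x y _ _ /=; apply: can_inj fK _ _.
by apply/setP=> y; rewrite inE morphimEdom; apply/imsetP; exists (f' y).
Qed.

(** * Additive torsion and the invariants derived from it *)

Section Zmodules.

Local Open Scope ring_scope.
Import GRing.Theory.

Lemma morph_add_mulrn (U V : zmodType) (g : U -> V) :
  {morph g : x y / x + y} -> forall x n, g (x *+ n) = g x *+ n.
Proof.
move=> gD x; have g0 : g 0 = 0.
  by apply: (addrI (g 0)); rewrite -gD !addr0.
by elim=> [|n IHn]; rewrite ?mulr0n // !mulrS gD IHn.
Qed.

(** Bézout: some multiple of [m] exceeds a multiple of [n] by exactly 1. *)
Lemma coprime_mulrn_eq0 (V : zmodType) (m n : nat) (v : V) :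
  (0 < m)%N -> coprime m n -> v *+ m = 0 -> v *+ n = 0 -> v = 0.
Proof.
move=> m_gt0 /eqP co_mn vm0 vn0; case: (egcdnP n m_gt0) => u w def_u _.
have := congr1 (GRing.natmul v) def_u.
rewrite mulrnDr ?co_mn mulr1n (mulnC u) (mulnC w) !mulrnA vm0 vn0 !mul0rn.
by rewrite add0r.
Qed.

(* Separates the B_{i,j}: for k = 4 it detects the parity of i, and for k = q
   that of j. *)
Definition lambda_fixes_torsion k (B : leftBraceType) :=
  forall a b : B, b *+ k = 0 -> lambda a b = b.

Lemma lambda_fixes_torsion_isom k (B C : leftBraceType) :
  brace_isom B C -> lambda_fixes_torsion k C -> lambda_fixes_torsion k B.
Proof.
case=> f [[f' fK _] fD fM] C_fix a b bk0; apply: (can_inj fK).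
rewrite (@brace_isom_lambda _ _ f) // C_fix // -(morph_add_mulrn fD) bk0.
by apply: (addrI (f 0)); rewrite -fD !addr0.
Qed.

End Zmodules.

(** * Additive maps of Z_q x Z_4 and square roots of 1 *)

Section Order4q.

Local Open Scope ring_scope.
Local Open Scope brace_scope.
Import GRing.Theory.

Variable q : nat.
Hypotheses (q_prime : prime q) (q_gt3 : (3 < q)%N).

Let q_odd : odd q.
Proof. by case: (even_prime q_prime) q_gt3 => // ->. Qed.

Let coprime_4q : coprime 4 q.
Proof. by rewrite (@coprime_pexpl 2 2) ?coprime2n. Qed.

Lemma Zq_mulrn (u : 'Z_q) : u *+ q = 0.
Proof. by rewrite -mulr_natr pchar_Zp ?mulr0 ?prime_gt1. Qed.

Lemma Z4_mulrn (u : 'Z_4) : u *+ 4 = 0.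
Proof. by case: u => [[|[|[|[|]]]]] // ?; apply/val_inj. Qed.

(** The off-diagonal entries of [g] are killed by both 4 and [q], which are coprime, so they
    vanish. *)
Lemma morph_add_diag (g : 'Z_q * 'Z_4 -> 'Z_q * 'Z_4) :
  {morph g : x y / x + y} ->
  exists c d, forall x, g x = (c * x.1, d * x.2).
Proof.
move=> gD; have gMn := morph_add_mulrn gD.
have fstMn (x : 'Z_q * 'Z_4) n : (x *+ n).1 = x.1 *+ n by apply: raddfMn.
have sndMn (x : 'Z_q * 'Z_4) n : (x *+ n).2 = x.2 *+ n by apply: raddfMn.
have g0 : g 0 = 0 by rewrite -[0](mulr0n 0) gMn.
have g1 : (g (1, 0)).2 = 0.
  apply: (@coprime_mulrn_eq0 _ 4 q) => //; first exact: Z4_mulrn.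
  rewrite -sndMn -gMn [_ *+ q](_ : _ = 0) ?g0 //.
  by rewrite [LHS]surjective_pairing fstMn sndMn Zq_mulrn mul0rn.
have g2 : (g (0, 1)).1 = 0.
  apply: (@coprime_mulrn_eq0 _ 4 q) => //; last exact: Zq_mulrn.
  rewrite -fstMn -gMn [_ *+ 4](_ : _ = 0) ?g0 //.
  by rewrite [LHS]surjective_pairing fstMn sndMn Z4_mulrn mul0rn.
exists (g (1, 0)).1, (g (0, 1)).2 => x.
(* The coordinates of [x] act here through their natural representatives, so additivity of [g] alone
   determines [g x]. *)
have {1}-> : x = (1, 0) *+ x.1 + (0, 1) *+ x.2.
  rewrite [RHS]surjective_pairing !raddfD !raddfMn /= !mul0rn addr0 add0r.
  by rewrite !natr_Zp -surjective_pairing.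
rewrite gD !gMn [LHS]surjective_pairing !raddfD !raddfMn /= g1 g2 !mul0rn.
by rewrite addr0 add0r -[in RHS](natr_Zp x.1) -[in RHS](natr_Zp x.2) !mulr_natr.
Qed.

(** For a natural representative [n], the prime [q] divides [n ^ 2 - 1], hence one of [n - 1] and
    [n + 1] by Euclid's lemma. *)
Lemma Zq_sqrt1 (c : 'Z_q) : c * c = 1 -> exists j : bool, c = (-1) ^+ j.
Proof.
rewrite -[c]natr_Zp; move: (nat_of_ord c) => n {c} nn1.
have q_char : q \in [pchar 'Z_q] by rewrite inE q_prime pchar_Zp ?prime_gt1 /=.
have n_gt0 : (0 < n)%N.
  rewrite lt0n; apply: contra_eq_neq nn1 => ->.
  by rewrite mul0r eq_sym oner_eq0.
have : (q %| n ^ 2 - 1 ^ 2)%N.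
  by rewrite (dvdn_pcharf q_char) natrB ?leq_sqr // exp1n natrX expr2 nn1 subrr.
rewrite subn_sqr Euclid_dvdM // !(dvdn_pcharf q_char) natrB // natrD.
case/orP=> [|]; last by rewrite addr_eq0 => /eqP->; exists true.
by rewrite subr_eq0 => /eqP->; exists false.
Qed.

Lemma Z4_sqrt1 (d : 'Z_4) : d * d = 1 -> exists i : bool, d = (-1) ^+ i.
Proof.
case: d => [[|[|[|[|]]]]] // ltd /(congr1 val) //= _; last exists true.
  by exists false; apply/val_inj.
by apply/val_inj.
Qed.

(** * The subgroup Z_q x 2Z_4 of index 2, and coordinates on a cyclic group of order 4q *)

Definition even_snd : {set 'Z_q * 'Z_4} := [set x : 'Z_q * 'Z_4 | ~~ odd x.2].

Lemma card_even_snd : #|even_snd| = (2 * q)%N.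
Proof.
have -> : even_snd = setX setT [set 0; 1 + 1].
  by apply/setP=> -[x y]; rewrite !inE; case: y => [[|[|[|[|]]]]].
by rewrite cardsX cardsT card_ord Zp_cast ?prime_gt1 // cards2 mulnC.
Qed.

Lemma two_Zq_neq0 : 1 + 1 != 0 :> 'Z_q.
Proof.
have q_gt1 := prime_gt1 q_prime; rewrite -val_eqE /= Zp_cast //.
by rewrite !modn_small ?(ltn_trans _ q_gt3).
Qed.

Lemma card_ZqZ4 : #|{: 'Z_q * 'Z_4}| = (4 * q)%N.
Proof. by rewrite card_prod !card_ord Zp_cast ?prime_gt1 // mulnC. Qed.

(** A direct product of cyclic groups of the coprime orders [q] and 4. *)
Lemma cyclic_ZqZ4 : cyclic [set: 'Z_q * 'Z_4].
Proof.
have cyclicZp p : cyclic [set: 'Z_p].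
  by apply/cyclicP; exists Zp1; apply: Zp_cycle.
have defG := setX_dprod [set: 'Z_q] [set: 'Z_4].
have -> : [set: 'Z_q * 'Z_4] = setX [set: 'Z_q] [set: 'Z_4].
  by apply/setP=> x; rewrite !inE.
rewrite (cyclic_dprod defG).
- rewrite -(card_isog (isog_setX1 _ _)) -(card_isog (isog_set1X _ _)) !cardsT.
  by rewrite !card_ord Zp_cast ?prime_gt1 // coprime_sym.
- by rewrite -(isog_cyclic (isog_setX1 _ _)); apply: cyclicZp.
by rewrite -(isog_cyclic (isog_set1X _ _)); apply: cyclicZp.
Qed.

Lemma cyclic_4q_coordinates (V : finLeftBraceType) :
    #|V| = (4 * q)%N -> cyclic [set: V] ->
  exists2 f : 'Z_q * 'Z_4 -> V, bijective f & {morph f : x y / x + y}.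
Proof.
move=> cardV cycV; have : [set: 'Z_q * 'Z_4] \isog [set: V].
  by rewrite (isog_cyclic_card _ cyclic_ZqZ4) cycV !cardsT cardV card_ZqZ4 /=.
case/isogP=> f /injmP f_inj _.
exists f; last by move=> x y; apply: morphM; rewrite inE.
apply: inj_card_bij; last by rewrite cardV card_ZqZ4.
by move=> x y; apply: f_inj; rewrite inE.
Qed.

(** In a finite group, closure under sums makes [K] a subgroup, so its order [2 * q] kills each of
    its elements. As [q] is odd, the second coordinate is then killed by 2, so it is even; equal
    cardinalities turn the inclusion into an equality. *)
Lemma sum_closed_eq_even_snd (K : {set 'Z_q * 'Z_4}) :
    #|K| = (2 * q)%N -> (forall x y, x \in K -> y \in K -> x + y \in K) ->
  K = even_snd.
Proof.
move=> cardK KD; have K0 : 0 \in K.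
  have /card_gt0P[x Kx] : (0 < #|K|)%N.
    by rewrite cardK muln_gt0 (prime_gt0 q_prime).
  have Kxn n : x *+ n.+1 \in K by elim: n => // n IHn; rewrite mulrS KD.
  (* Zero is reached as a positive multiple of [x]; the exponent is written as a successor to match
     [Kxn]. *)
  have x4q : x *+ (4 * q).-1.+1 = 0.
    rewrite prednK; last by rewrite muln_gt0 (prime_gt0 q_prime).
    rewrite [LHS]surjective_pairing (raddfMn fst) (raddfMn snd).
    congr pair; first by rewrite mulrnA Zq_mulrn.
    by rewrite mulnC mulrnA Z4_mulrn.
  by rewrite -x4q.
have K_group : group_set K.
  by apply/group_setP; split=> [|x y]; [apply: K0 | apply: KD].
apply/eqP; rewrite eqEcard cardK card_even_snd // leqnn andbT.
apply/subsetP=> x Kx; rewrite inE.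
have := expg_cardG (G := Group K_group) Kx.
rewrite cardK => /(congr1 snd).
have -> : (x ^+ (2 * q))%g.2 = x.2 *+ (2 * q) by apply: (raddfMn snd).
have: forall y : 'Z_4, y *+ (2 * q) = y *+ 2.
  move=> y; rewrite -(odd_double_half q) q_odd mulnDr mulrnDr muln1.
  by rewrite -mul2n mulnA mulrnA Z4_mulrn mul0rn addr0.
by move=> ->; case: (x.2) => [[|[|[|[|]]]]] // ? /(congr1 val).
Qed.

(** * Every brace with the given invariants is one of the B_{i,j} *)

Lemma brace_isom_Bij (B : finLeftBraceType) :
    #|B| = (4 * q)%N -> cyclic [set: B] -> #|ker_lambda B| = (2 * q)%N ->
  exists2 ij, ij \in Bij_indices & brace_isom B (Bij q ij.1 ij.2).
Proof.
move=> cardB cycB cardKer.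
have [f [f' fK f'K] fD] := cyclic_4q_coordinates cardB cycB.
(* [L] is lambda read in the coordinates [f]; there the circle product of [a] and [b] is
   [a + L a b]. *)
pose L a x := f' (lambda (f a) (f x)).
have f'D : {morph f' : a b / a + b}.
  by move=> a b; rewrite -{1}[a]f'K -{1}[b]f'K -fD fK.
have fL a x : f (L a x) = lambda (f a) (f x) by rewrite /L f'K.
have f_circ a x : f a ∘ f x = f (a + L a x) by rewrite circ_lambda fD fL.
have LD a : {morph L a : x y / x + y} by move=> x y; rewrite /L fD lambdaD f'D.
have L_circ a b x : L (a + L a b) x = L a (L b x).
  by rewrite {1}/L -f_circ lambda_circ -fL -fL fK.
pose K := f @^-1: ker_lambda B.
have KP a : reflect (forall x, L a x = x) (a \in K).
  rewrite inE; apply: (iffP (ker_lambdaP _)) => a_id x.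
    by rewrite /L a_id fK.
  by rewrite -[x]f'K -fL a_id.
have defK : K = even_snd.
  apply: sum_closed_eq_even_snd.
    rewrite on_card_preimset //.
    by exists f' => // x _; apply: f'K.
  (* For [x] in the kernel, [x + y] is [x + L x y], so it acts as a circle product. *)
  move=> x y /KP Kx /KP Ky; apply/KP => z.
  by rewrite -{1}[y]Kx L_circ Ky.
have KE a : (a \in K) = ~~ odd a.2 by rewrite defK inE.
pose e : 'Z_q * 'Z_4 := (0, 1).
have [c [d def_L]] := morph_add_diag (LD e).
have LeK x : L e (L e x) = x.
  rewrite -L_circ; apply/KP; rewrite KE def_L.
  have -> : (e + (c * e.1, d * e.2)).2 = 1 + d by rewrite -[d in RHS]mulr1.
  rewrite odd_Z4D.
  (* The second coordinate of [e ∘ e] is [1 + d], so [d] has to be odd. An even [d] would make [L e]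
     kill the nonzero element (0, 2), against the injectivity of lambda. *)
  have : L e (0, 1 + 1) != 0.
    apply/eqP=> L0; have /lambda_eq0 : lambda (f e) (f (0, 1 + 1)) = 0.
      by rewrite -fL L0; apply: (addrI (f 0)); rewrite -fD !addr0.
    have <- : f 0 = 0 by apply: (addrI (f 0)); rewrite -fD !addr0.
    by move/(can_inj fK).
  by rewrite def_L /= mulr0; case: (d) => [[|[|[|[|]]]]].
(* The involution [L e] is diagonal, so both its entries square to 1. *)
have [j def_c] : exists j : bool, c = (-1) ^+ j.
  apply: Zq_sqrt1 => //; have /(congr1 fst) := LeK (1, 0).
  by rewrite !def_L /= mulr1.
have [i def_d] : exists i : bool, d = (-1) ^+ i.
  apply: Z4_sqrt1; have /(congr1 snd) := LeK (0, 1).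
  by rewrite !def_L /= mulr1.
have ij_neq0 : i || j.
  have : e \notin K by rewrite KE.
  apply: contraR; rewrite negb_or => /andP[/negbTE i0 /negbTE j0].
  apply/KP=> x; rewrite def_L def_c def_d i0 j0 !mul1r.
  by rewrite -surjective_pairing.
have def_La a x :
    L a x = ((-1) ^+ (j * a.2)%N * x.1, (-1) ^+ (i * a.2)%N * x.2).
  have [a_odd|a_even] := boolP (odd a.2); last first.
    rewrite !(@sign_parity _ _ a.2 0) ?(negbTE a_even) // !muln0 !mul1r.
    by rewrite -surjective_pairing; apply: (KP a _); rewrite KE.
  rewrite !(@sign_parity _ _ a.2 1) // !muln1 -def_c -def_d -def_L.
  have Kae : a - e \in K.
    by rewrite KE [(a - e).2](_ : _ = a.2 - 1) // odd_Z4D odd_Z4N a_odd.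
  have {1}-> : a = a - e + L (a - e) e by rewrite (KP _ Kae) subrK.
  by rewrite L_circ (KP _ Kae).
exists (nat_of_bool i, nat_of_bool j).
  by case: (i) (j) ij_neq0 => [] [].
exists f'; split=> //; first by exists f.
move=> a b; apply: (can_inj fK).
rewrite f'K -{1}[a]f'K -{1}[b]f'K f_circ def_La.
by case: (f' a) (f' b) => [n m] [x y].
Qed.

(** * Invariants of the B_{i,j}, and their pairwise non-isomorphism *)

Lemma Z4_sign_eq1 k : (-1) ^+ k = 1 :> 'Z_4 -> ~~ odd k.
Proof. by apply: contra_eqN => k_odd; rewrite -signr_odd k_odd. Qed.

Lemma Zq_sign_eq1 k : (-1) ^+ k = 1 :> 'Z_q -> ~~ odd k.
Proof.
apply: contra_eqN => k_odd; rewrite -signr_odd k_odd expr1 eq_sym -subr_eq0.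
by rewrite opprK two_Zq_neq0.
Qed.

Lemma lambda_Bij i j (a b : Bij q i j) :
  lambda a b = ((-1) ^+ (j * a.2)%N * b.1, (-1) ^+ (i * a.2)%N * b.2).
Proof.
by case: a b => [n m] [x y]; congr pair; rewrite /= addKr.
Qed.

(** If [a] fixes the generators (1, 0) and (0, 1), then [j * a.2] and [i * a.2] are even; since [i]
    or [j] is odd, [a.2] is even. *)
Lemma ker_lambda_Bij i j : odd i || odd j ->
  ker_lambda (Bij q i j) =i even_snd.
Proof.
move=> ij_odd a; rewrite [RHS]inE; apply/ker_lambdaP/idP=> [a_id|a_even].
  have := a_id (1, 0); have := a_id (0, 1).
  rewrite !lambda_Bij /= !mulr1 => -[_ /Z4_sign_eq1 i1] [/Zq_sign_eq1 j1 _].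
  move: i1 j1; rewrite !oddM; case: (odd a.2) => //.
  by rewrite !andbT => /negbTE i1 /negbTE j1; rewrite i1 j1 in ij_odd.
move=> b; rewrite lambda_Bij !(@sign_parity _ _ a.2 0) ?(negbTE a_even) //.
by rewrite !muln0 !mul1r -surjective_pairing.
Qed.

Lemma Bij_isom_invariants i j (B : finLeftBraceType) :
    odd i || odd j -> brace_isom B (Bij q i j) ->
  [/\ #|B| = (4 * q)%N, cyclic [set: B] & #|ker_lambda B| = (2 * q)%N].
Proof.
move=> ij_odd isoB; have [f [f_bij fD fM]] := isoB; split.
- by rewrite (bij_eq_card f_bij) card_ZqZ4.
- rewrite (isog_cyclic (M := [set: 'Z_q * 'Z_4])); first exact: cyclic_ZqZ4.
  exact: (@isog_bij _ _ f fD f_bij).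
rewrite (card_ker_lambda_isom isoB) (eq_card (ker_lambda_Bij ij_odd)).
exact: card_even_snd.
Qed.

(** The 4-torsion is the factor Z_4, on which lambda acts by the sign with exponent [i * a.2]; the
    element (0, 1) tests it. *)
Lemma Bij_fixes_4_torsion i j :
  reflect (lambda_fixes_torsion 4 (Bij q i j)) (~~ odd i).
Proof.
apply: (iffP idP) => [i_even a b b40 | fix4].
  have b1 : b.1 = 0.
    apply: (@coprime_mulrn_eq0 _ 4 q) => //; last exact: Zq_mulrn.
    by rewrite -(raddfMn fst) b40.
  rewrite lambda_Bij b1 mulr0 -signr_odd oddM (negbTE i_even) mul1r -b1.
  by rewrite -surjective_pairing.
have tors : (0, 1) *+ 4 = 0 :> Bij q i j.
  rewrite [LHS]surjective_pairing (raddfMn fst) (raddfMn snd) mul0rn.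
  by rewrite Z4_mulrn.
have /(congr1 snd) := fix4 (0, 1) (0, 1) tors.
by rewrite lambda_Bij /= mulr1 muln1 => /Z4_sign_eq1.
Qed.

(** The q-torsion is the factor Z_q, where the exponent of the sign is [j * a.2]. *)
Lemma Bij_fixes_q_torsion i j :
  reflect (lambda_fixes_torsion q (Bij q i j)) (~~ odd j).
Proof.
apply: (iffP idP) => [j_even a b bq0 | fixq].
  have b2 : b.2 = 0.
    apply: (@coprime_mulrn_eq0 _ 4 q) => //.
    - exact: Z4_mulrn.
    by rewrite -(raddfMn snd) bq0.
  rewrite lambda_Bij b2 mulr0 -signr_odd oddM (negbTE j_even) mul1r -b2.
  by rewrite -surjective_pairing.
have tors : (1, 0) *+ q = 0 :> Bij q i j.
  rewrite [LHS]surjective_pairing (raddfMn fst) (raddfMn snd) mul0rn.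
  by rewrite Zq_mulrn.
have /(congr1 fst) := fixq (0, 1) (1, 0) tors.
by rewrite lambda_Bij /= mulr1 muln1 => /Zq_sign_eq1.
Qed.

(** The two torsion conditions are isomorphism invariants and give the parities of the indices,
    which separate the three listed pairs. *)
Lemma Bij_isom_eq ij kl :
    ij \in Bij_indices -> kl \in Bij_indices ->
  brace_isom (Bij q ij.1 ij.2) (Bij q kl.1 kl.2) -> ij = kl.
Proof.
move=> ij_in kl_in isoB; have isoC := brace_isom_sym isoB.
have ij1 : odd ij.1 = odd kl.1.
  apply: negb_inj;
    apply/(Bij_fixes_4_torsion _ ij.2)/(Bij_fixes_4_torsion _ kl.2);
    exact: lambda_fixes_torsion_isom.
have ij2 : odd ij.2 = odd kl.2.
  apply: negb_inj;
    apply/(Bij_fixes_q_torsion ij.1)/(Bij_fixes_q_torsion kl.1);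
    exact: lambda_fixes_torsion_isom.
move: ij_in kl_in ij1 ij2; rewrite !inE.
by case/or3P=> /eqP-> /or3P[]/eqP->.
Qed.

(** * The circle groups of the three braces *)

Section CircGroups.

Local Open Scope group_scope.

Lemma circ_groupE i j (n x : 'Z_q) (m y : 'Z_4) :
  ((n, m) : circ_group (Bij q i j)) * ((x, y) : circ_group (Bij q i j)) =
  ((n + (-1) ^+ (j * m)%N * x)%R, (m + (-1) ^+ (i * m)%N * y)%R).
Proof. by []. Qed.

Lemma circ_group_expg1 i j n :
  ((1, 0)%R : circ_group (Bij q i j)) ^+ n = (n%:R, 0)%R.
Proof.
elim: n => // n IHn; rewrite expgS IHn circ_groupE !muln0 !expr0 !mul1r.
by rewrite -mulrS add0r.
Qed.

(** On the factor Z_4 the law [m + (-1) ^+ m * y] is bitwise exclusive or, so [f] sends [m] to its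
    two binary digits; on Z_q the law is addition. *)
Lemma isog_circ_Bij10 :
  [set: circ_group (Bij q 1 0)] \isog [set: ('Z_2 * 'Z_2 * 'Z_q)%type].
Proof.
pose f (a : circ_group (Bij q 1 0)) : ('Z_2 * 'Z_2 * 'Z_q)%type :=
  (inZp (odd a.2), inZp (1 < a.2)%N, a.1).
apply: (@isog_bij _ _ f).
  move=> [n m] [x y]; rewrite circ_groupE /f /=; congr (_, _, _); last first.
    by rewrite mul0n expr0 mul1r.
  - by apply/val_inj; case: m y => [[|[|[|[|]]]]] // ? [[|[|[|[|]]]]].
  - by apply/val_inj; case: m y => [[|[|[|[|]]]]] // ? [[|[|[|[|]]]]].
apply: inj_card_bij; last by rewrite !card_prod !card_ord mulnC.
move=> [n m] [x y] /= [m0 m1 ->]; congr pair; apply/val_inj; move: m0 m1.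
by case: m y => [[|[|[|[|]]]]] // ? [[|[|[|[|]]]]].
Qed.

Lemma circ_group_prod i j (n : 'Z_q) (m : 'Z_4) :
  ((n, 0%R) : circ_group (Bij q i j)) * ((0%R, m) : circ_group (Bij q i j)) =
  (n, m).
Proof. by rewrite circ_groupE !muln0 !expr0 !mul1r addr0 add0r. Qed.

Lemma circ_group_inv1 i j :
  ((1, 0)%R : circ_group (Bij q i j))^-1 = (-1, 0)%R.
Proof.
apply: (mulgI ((1, 0)%R : circ_group (Bij q i j))).
by rewrite mulgV circ_groupE !muln0 !expr0 !mul1r subrr addr0.
Qed.

(** The universal half of the presentation: (n, m) goes to [y ^+ n * x ^+ m], and the relations make
    this multiplicative. *)
Lemma homg_circ_Bij01 (rT : finGroupType) (x y : rT) :
    x ^+ 4 = 1 -> y ^+ q = 1 -> x * y * x^-1 = y^-1 ->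
  <[x]> <*> <[y]> \homg [set: circ_group (Bij q 0 1)].
Proof.
move=> x4 yq xyV; have q_gt1 := prime_gt1 q_prime.
have yX (n m : 'Z_q) : y ^+ (n + m)%R = y ^+ n * y ^+ m.
  by rewrite /= expg_mod ?expgD // Zp_cast.
have xX (n m : 'Z_4) : x ^+ (n + m)%R = x ^+ n * x ^+ m.
  by rewrite /= expg_mod ?expgD.
have yN (n : 'Z_q) : y ^+ (- n)%R = y ^- n.
  by apply: (mulgI (y ^+ n)); rewrite mulgV -yX subrr.
have xy (k : nat) : x * y ^+ k = y ^- k * x.
  by rewrite conjgCV conjXg /conjg invgK mulgA xyV expgVn.
(* Each factor [x] moved past a power of [y] inverts it, which is the sign in the circle law of
   B_{0,1}. *)
have xXy (m : nat) (k : 'Z_q) :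
    x ^+ m * y ^+ k = y ^+ ((-1) ^+ m * k)%R * x ^+ m.
  elim: m => [|m IHm]; first by rewrite expr0 !mul1r mul1g mulg1.
  by rewrite expgS -mulgA IHm mulgA xy -yN mulgA exprS mulN1r mulNr.
pose f (a : circ_group (Bij q 0 1)) := y ^+ a.1 * x ^+ a.2.
have fM : {in setT &, {morph f : a b / a * b}}.
  move=> [n m] [n' m'] _ _; rewrite circ_groupE /f mul1n mul0n expr0 mul1r.
  rewrite -[LHS]/(y ^+ (n + (-1) ^+ m * n')%R * x ^+ (m + m')%R) yX xX.
  by rewrite !mulgA -(mulgA (y ^+ n)) -xXy !mulgA.
apply/homgP; exists (Morphism fM); apply/eqP; rewrite eqEsubset.
rewrite join_subG !cycle_subG; apply/and3P; split.
- apply/subsetP=> _ /morphimP[a _ _ ->].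
  by rewrite groupM ?groupX // mem_gen // inE cycle_id ?orbT.
- have -> : x = Morphism fM (0, 1)%R by rewrite /= /f mul1g.
  by rewrite mem_morphim ?inE.
have -> : y = Morphism fM (1, 0)%R.
  by rewrite /= /f mulg1 /= Zp_cast // modn_small.
by rewrite mem_morphim ?inE.
Qed.

(** By [homg_circ_Bij01] it remains to find generators satisfying the relations: (0, 1) for [s] and
    (1, 0) for [t]. *)
Lemma isog_Grp_circ_Bij01 :
  [set: circ_group (Bij q 0 1)] \isog
    Grp (s : t : (s ^+ 4, t ^+ q, s * t * s^-1 = t^-1)).
Proof.
apply: intro_isoGrp => [|rT H]; last first.
  case/existsP=> -[x y] /=; rewrite !xpair_eqE.
  case/and4P=> /eqP <- /eqP x4 /eqP yq /eqP xyV; exact: homg_circ_Bij01.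
pose gT := circ_group (Bij q 0 1).
suffices [s [t [genG s4 tq st]]] : exists s t : gT,
    [/\ <[s]> <*> <[t]> = setT, s ^+ 4 = 1, t ^+ q = 1 & s * t * s^-1 = t^-1].
  by apply/existsP; exists (s, t); rewrite /= !xpair_eqE genG s4 tq st !eqxx.
have sX n : ((0, 1)%R : gT) ^+ n = (0, n%:R)%R.
  elim: n => // n IHn; rewrite expgS IHn circ_groupE mul0n expr0 mul1r.
  by rewrite mulr0 add0r -mulrS.
exists (0, 1)%R, (1, 0)%R; split.
- apply/eqP; rewrite eqEsubset subsetT; apply/subsetP=> -[n m] _.
  have -> : (n, m) = ((1, 0)%R : gT) ^+ n * ((0, 1)%R : gT) ^+ m.
    by rewrite circ_group_expg1 sX !natr_Zp circ_group_prod.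
  by rewrite groupM ?groupX // mem_gen // inE cycle_id ?orbT.
- by rewrite sX; congr pair; apply/val_inj.
- by rewrite circ_group_expg1 pchar_Zp ?prime_gt1.
apply: (canLR (mulgK _)); rewrite circ_group_inv1 !circ_groupE.
by rewrite !mul0n muln0 muln1 expr1 !expr0 !mul1r !mulr1 !addr0 !add0r.
Qed.

(** The group is the internal direct product of the central subgroup [Z], of order 2, and the
    dihedral subgroup [D] with rotation (1, 0) and reflection (0, 1). *)
Lemma isog_circ_Bij11 :
  [set: circ_group (Bij q 1 1)] \isog setX [set: 'Z_2] 'D_(2 * q).
Proof.
have q_gt1 := prime_gt1 q_prime.
pose gT := circ_group (Bij q 1 1).
pose Z : {set gT} := [set a : gT | (a.1 == 0%R) && ~~ odd a.2].
(* [D] is closed because the second coordinate of (n, 1) ∘ (x, 1) is 1 - 1 = 0. *)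
pose D : {set gT} := [set a : gT | (a.2 <= 1)%N].
have inZ (n : 'Z_q) (m : 'Z_4) : ((n, m) \in Z) = (n == 0%R) && ~~ odd m.
  by rewrite inE.
have Z_group : group_set Z.
  apply/group_setP; split; first by rewrite inZ eqxx.
  move=> [n m] [x y]; rewrite circ_groupE !inZ => /andP[/eqP-> /negbTE m0].
  case/andP=> /eqP-> /negbTE y0.
  by rewrite mulr0 addr0 eqxx odd_Z4D odd_Z4M m0 y0.
have D_group : group_set D.
  apply/group_setP; split; first by rewrite !inE.
  move=> [n m] [x y]; rewrite circ_groupE !inE /=.
  by case: m y => [[|[|[|[|]]]]] // ? [[|[|[|[|]]]]].
have cardZ : #|Z| = 2.
  have -> : Z = [set (0, 0)%R; (0, 1 + 1)%R].
    apply/setP=> -[n m]; rewrite !inE /= !xpair_eqE -andb_orr.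
    by congr andb; case: m => [[|[|[|[|]]]]].
  by rewrite cards2.
have cardD : #|D| = (2 * q)%N.
  have -> : D = setX [set: 'Z_q] [set 0%R; 1%R].
    by apply/setP=> -[n m]; rewrite !inE /=; case: m => [[|[|[|[|]]]]].
  by rewrite cardsX cardsT card_ord Zp_cast // cards2 mulnC.
pose ZG := Group Z_group; pose DG := Group D_group.
have defG : ZG \x DG = [set: gT].
  rewrite dprodE.
  - apply/eqP; rewrite eqEsubset subsetT; apply/subsetP=> -[n m] _.
    (* The two binary digits of [m] are split between [Z] and [D]. *)
    have -> : (n, m) = ((0, if (1 < m)%N then 1 + 1 else 0)%R : gT)
                         * (n, inZp (odd m)).
      rewrite circ_groupE; case: m => [[|[|[|[|]]]]] // ltm; rewrite /=;
        congr pair; try apply/val_inj;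
        by rewrite // ?mul1n ?sqrrN ?expr1n ?expr0 ?mul1r add0r.
    by apply: mem_mulg; rewrite !inE /=; case: m => [[|[|[|[|]]]]].
  (* [Z] is central: an even [m] induces no sign, and [- m = m] in Z_4 absorbs the sign put on
     it. *)
  - apply/centsP=> -[x y] _ [n m]; rewrite inZ => /andP[/eqP-> m0].
    apply/esym; rewrite /commute !circ_groupE mulr0 addr0 add0r mul1n.
    rewrite -signr_odd (negbTE m0) !mul1r; congr pair; apply/val_inj.
    by case: m y m0 => [[|[|[|[|]]]]] // ? [[|[|[|[|]]]]].
  apply/trivgP/subsetP=> -[n m]; rewrite inE inZ => /andP[/andP[/eqP-> m0]].
  rewrite !inE /= => m1.
  by case: m m0 m1 => [[|[|[|[|]]]]].
apply: (isog_dprod defG (setX_dprod _ _)).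
  apply: isog_trans (isog_setX1 _ _).
  by rewrite isog_cyclic_card ?prime_cyclic ?cardZ // cardsT card_ord.
apply: isog_trans (isog_set1X _ _).
(* Given equal orders, it suffices that [D] has generators satisfying the dihedral relations. *)
rewrite mul2n; apply/(isoGrpP _ (Grp_dihedral q_gt1)).
split; first by rewrite cardD card_dihedral // mul2n.
suffices [r [s [genD rq s2 rs]]] : exists r s : gT,
    [/\ <[r]> <*> <[s]> = D, r ^+ q = 1, s ^+ 2 = 1 & r ^ s = r^-1].
  by apply/existsP; exists (r, s); rewrite /= !xpair_eqE genD rq s2 rs !eqxx.
exists (1, 0)%R, (0, 1)%R; split.
- apply/eqP; rewrite eqEsubset -[D]/(gval DG) join_subG !cycle_subG.
  apply/andP; split; first by rewrite !inE.
  apply/subsetP=> -[n m]; rewrite inE /= => m_le1.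
  have -> : (n, m) = ((1, 0)%R : gT) ^+ n * ((0, 1)%R : gT) ^+ m.
    rewrite circ_group_expg1 natr_Zp; case: m m_le1 => [[|[|]]] // ltm _.
      by rewrite mulg1; congr pair; apply/val_inj.
    by rewrite expg1 circ_group_prod; congr pair; apply/val_inj.
  by rewrite groupM ?groupX // mem_gen // inE cycle_id ?orbT.
- by rewrite circ_group_expg1 pchar_Zp.
- by congr pair; [rewrite mulr0 addr0 | apply/val_inj].
rewrite /conjg; apply: (canLR (mulKg _)); rewrite circ_group_inv1 !circ_groupE.
by rewrite !mul1n expr0 expr1 !mulr0 mulN1r opprK !mul1r !addr0 !add0r.
Qed.

End CircGroups.

End Order4q.

Unset Implicit Arguments.

Theorem proposition7p1 (q : nat) (q_prime : prime q) (q_gt3 : (3 < q)%N)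
    (q_mod4 : q <> 1 %[mod 4]) :
  [/\ (forall B : finLeftBraceType,
        [/\ #|B| = (4 * q)%N, cyclic [set: B]
          & #|ker_lambda B| = (2 * q)%N]
        <-> exists2 ij, ij \in Bij_indices & brace_isom B (Bij q ij.1 ij.2)),
      (forall ij kl, ij \in Bij_indices -> kl \in Bij_indices ->
        brace_isom (Bij q ij.1 ij.2) (Bij q kl.1 kl.2) -> ij = kl),
      [set: circ_group (Bij q 0 1)] \isog
        Grp (s : t : (s ^+ 4, t ^+ q, s * t * s^-1 = t^-1)),
      [set: circ_group (Bij q 1 1)] \isog setX [set: 'Z_2] 'D_(2 * q)
    & [set: circ_group (Bij q 1 0)] \isog
        [set: ('Z_2 * 'Z_2 * 'Z_q)%type]]%g.
Proof.
split.
- move=> B; split=> [[cardB cycB cardKer] | [ij ij_in isoB]].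
    exact: brace_isom_Bij.
  apply: (Bij_isom_invariants q_prime q_gt3 _ isoB).
  by move: ij_in; rewrite !inE; case/or3P=> /eqP->.
- exact: Bij_isom_eq.
- exact: isog_Grp_circ_Bij01.
- exact: isog_circ_Bij11.
exact: isog_circ_Bij10.
Qed.
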